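(* Let $X$ be a simplicial complex, $\alpha\in C^k(X)$, $\beta\in C^l(X)$, and let $\sigma$ be a $(k+l)$-simplex in $X$. Then the discrete wedge product satisfies $$\langle\alpha\wedge\beta,\sigma\rangle=\frac{1}{\binom{k+l+1}{k+1}}\sum_{f^k\prec\sigma}\langle\alpha,f\rangle\left(\frac{1}{k+1}\sum_{v^0\prec f}\langle\beta,\,v*(\sigma\setminus f)\rangle\right)$$ $$=\frac{1}{\binom{k+l+1}{l+1}}\sum_{f^l\prec\sigma}\left(\frac{1}{l+1}\sum_{v^0\prec f}\langle\alpha,\,v*(\sigma\setminus f)\rangle\right)\langle\beta,f\rangle,$$ where the orientations of $f$ and $v*(\sigma\setminus f)$ are such that the ordering $(f\setminus\{v\},\,v,\,\sigma\setminus f)$ corresponds to an even permutation in $S_{k+l+1}$.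
   Context: Chains and cochains: $X$ is a simplicial complex (for instance a triangulation of a manifold), $C_k(X)$ is the real vector space of simplicial $k$-chains of $X$, generated by oriented $k$-simplices $[v_0,\ldots,v_k]$ (which change sign under odd permutations of the vertices), $C^k(X)$ is the corresponding space of $k$-cochains, and $\langle\alpha,c\rangle$ denotes evaluation of a cochain on a chain. Here $k,l\ge 0$ are integers. Cup product: for $\alpha\in C^k(X)$, $\beta\in C^l(X)$ and an ordering $v_0,\ldots,v_{k+l}$ of the vertices of a $(k+l)$-simplex, $\langle\alpha\smile\beta,[v_0,\ldots,v_{k+l}]\rangle=\langle\alpha,[v_0,\ldots,v_k]\rangle\,\langle\beta,[v_k,\ldots,v_{k+l}]\rangle$ (evaluated for the given ordering). Discrete wedge product: $\alpha\wedge\beta\in C^{k+l}(X)$ is defined on a $(k+l)$-simplex, whose vertices are labelled $0,\ldots,k+l$, by $$\langle\alpha\wedge\beta,[0\ldots k+l]\rangle=\frac{1}{(k+l+1)!}\sum_{\tau\in S_{k+l+1}}\operatorname{sgn}(\tau)\,\langle\alpha\smile\beta,[\tau(0)\ldots\tau(k+l)]\rangle,$$ and extended linearly to chains, where $S_{k+l+1}$ is the group of permutations of $\{0,\ldots,k+l\}$. Notation: $f^k\prec\sigma$ denotes a $k$-face $f$ of $\sigma$, ignoring orientation, i.e. a subset of $k+1$ vertices of $\sigma$ (similarly $f^l\prec\sigma$, and $v^0\prec f$ denotes a vertex $v$ of $f$). $\sigma\setminus f$ is the face of $\sigma$ formed by deleting the vertices of $f$ from those of $\sigma$, and for a simplex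 $g$ and a vertex $v$, $v*g$ is the simplex on the union of $\{v\}$ with the vertex set of $g$. Whenever a simplex occurs in the evaluation of a cochain it is taken to be oriented; the specific orientation is not shown by the notation. With the vertices of $\sigma$ labelled so that $\sigma=[0\ldots k+l]$, an ordering of all the vertices of $\sigma$ corresponds to the permutation $\rho\in S_{k+l+1}$ for which the ordering is $(\rho(0),\ldots,\rho(k+l))$; an ordering written $(f\setminus\{v\},v,\sigma\setminus f)$ lists the vertices of $f$ other than $v$, then $v$, then the vertices of $\sigma\setminus f$, the same symbols being used for the sets of vertices and for orderings of them.
   Formalization: In the second formula the evenness condition is imposed on the ordering (σ\f, v, f\{v}) instead of (f\{v}, v, σ\f); as written, that formula has the wrong sign when k and l are both odd (e.g. k=l=1), and the two conditions agree when kl is even. *)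

(* Defs.v *)
From HB Require Import structures.
From mathcomp Require Import all_boot all_order all_fingroup all_algebra.
From mathcomp Require Import finmap.
From mathcomp Require Import boolp classical_sets functions cardinality fsbigop.
From mathcomp Require Import reals.

Set Implicit Arguments.
Unset Strict Implicit.
Unset Printing Implicit Defensive.

Import GRing.Theory.

Local Open Scope classical_set_scope.
Local Open Scope ring_scope.

Record simplicial_complex (V : choiceType) := SimplicialComplex {
  simplices :> set {fset V};
  simplex_neq0 : forall A, simplices A -> A != fset0;
  simplex_sub : forall A B : {fset V},
    simplices A -> (B `<=` A)%fset -> B != fset0 -> simplices B
}.

(* A k-simplex of X together with an ordering v_0, ..., v_k of its vertices. *)
Record osimplex (V : choiceType) (X : simplicial_complex V) (k : nat) :=
  OSimplex {
    vtx :> {ffun 'I_k.+1 -> V};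
    vtxP : injectiveb vtx && ([fset vtx i | i : 'I_k.+1]%fset \in (X : set _))
  }.

HB.instance Definition _ (V : choiceType) (X : simplicial_complex V) k :=
  [isSub for @vtx V X k].
HB.instance Definition _ (V : choiceType) (X : simplicial_complex V) k :=
  [Choice of osimplex X k by <:].

Section OrderedSimplices.
Variables (V : choiceType) (X : simplicial_complex V).

Fact sub_osimplex_subproof n m (s : osimplex X n) (g : 'I_m.+1 -> 'I_n.+1) :
  injective g ->
  injectiveb [ffun i => s (g i)] &&
  ([fset [ffun i => s (g i)] i | i : 'I_m.+1]%fset \in (X : set _)).
Proof.
move=> injg; set t := finfun _; have /andP[/injectiveP injs /set_mem Xs] := vtxP s.
apply/andP; split.
  by apply/injectiveP => i j; rewrite !ffunE => /injs/injg.
apply/mem_set/(simplex_sub Xs).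
  apply/fsubsetP => x /imfsetP[i _ ->]; rewrite ffunE.
  by apply/imfsetP; exists (g i).
by apply/fset0Pn; exists (t ord0); apply/imfsetP; exists ord0.
Qed.

(* [s (g 0), ..., s (g m)] *)
Definition sub_osimplex n m (s : osimplex X n) (g : 'I_m.+1 -> 'I_n.+1)
    (injg : injective g) : osimplex X m :=
  OSimplex (sub_osimplex_subproof s injg).

(* [s (tau 0), ..., s (tau n)] *)
Definition reorder n (s : osimplex X n) (tau : 'S_n.+1) : osimplex X n :=
  sub_osimplex s (@perm_inj _ tau).

Definition front_idx k l (i : 'I_k.+1) : 'I_(k + l).+1 := inord i.
Definition back_idx k l (i : 'I_l.+1) : 'I_(k + l).+1 := inord (k + i).
Definition mid_idx k l : 'I_(k + l).+1 := inord k.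

Fact front_idx_inj k l : injective (@front_idx k l).
Proof.
move=> i j /(congr1 (@nat_of_ord _)).
by rewrite !inordK ?ltnS ?(leq_trans (leq_ord _) (leq_addr _ _))// => /val_inj.
Qed.

Fact back_idx_inj k l : injective (@back_idx k l).
Proof.
move=> i j /(congr1 (@nat_of_ord _)); rewrite !inordK ?ltnS ?leq_add2l ?leq_ord//.
by move/addnI/val_inj.
Qed.

(* [v_0, ..., v_k] and [v_k, ..., v_(k+l)] for s = [v_0, ..., v_(k+l)] *)
Definition front k l (s : osimplex X (k + l)) : osimplex X k :=
  sub_osimplex s (@front_idx_inj k l).
Definition back k l (s : osimplex X (k + l)) : osimplex X l :=
  sub_osimplex s (@back_idx_inj k l).

Lemma reorderE n (s : osimplex X n) (tau : 'S_n.+1) i :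
  reorder s tau i = s (tau i).
Proof. by rewrite ffunE. Qed.

Lemma reorderM n (s : osimplex X n) (tau rho : 'S_n.+1) :
  reorder (reorder s tau) rho = reorder s (rho * tau)%g.
Proof. by apply/val_inj/ffunP => i; rewrite !reorderE permM. Qed.

Lemma reorder1 n (s : osimplex X n) : reorder s 1%g = s.
Proof. by apply/val_inj/ffunP => i; rewrite reorderE perm1. Qed.

Lemma reorder_inj n (s : osimplex X n) : injective (reorder s).
Proof.
move=> tau rho e; apply/permP => i.
have /andP[/injectiveP injs _] := vtxP s.
by apply: injs; rewrite -!reorderE e.
Qed.

End OrderedSimplices.

Section Chains.
Variables (R : realType) (V : choiceType) (X : simplicial_complex V) (k : nat).

(* A chain is given by its coefficients on the oriented simplices: a finitely
   supported function of the ordered simplices that changes sign under odd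
   permutations of the vertices. The oriented simplices [v_0, ..., v_k]
   (oriented below) generate the space (chain_generated). *)
Definition is_chain : {pred osimplex X k -> R^o} := fun c =>
  `[< (forall s tau, c (reorder s tau) = (-1) ^+ tau * c s) /\
      finite_set [set s | c s != 0] >].

Fact is_chain_submod_closed : submod_closed is_chain.
Proof.
split=> [|a c d /asboolP[cP cfin] /asboolP[dP dfin]]; apply/asboolP; split.
- by move=> s tau; rewrite mulr0.
- rewrite (_ : [set s | _] = set0) //; apply/seteqP; split=> s //=.
  by rewrite eqxx.
- move=> s tau.
  change (a * c (reorder s tau) + d (reorder s tau) =
          (-1) ^+ tau * (a * c s + d s)).
  by rewrite cP dP mulrDr mulrCA.
- apply: (@sub_finite_set _ _ ([set s | c s != 0] `|` [set s | d s != 0])).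
    move=> s /=; change (a * c s + d s != 0 -> c s != 0 \/ d s != 0) => h.
    case: (eqVneq (c s) 0) => [c0|]; last by left.
    by right; apply: contra h => /eqP ->; rewrite c0 mulr0 addr0.
  by rewrite finite_setU.
Qed.

HB.instance Definition _ :=
  GRing.isSubmodClosed.Build R (osimplex X k -> R^o) is_chain
    is_chain_submod_closed.

(* The space C_k(X). *)
Record chain := Chain {
  chain_coef :> osimplex X k -> R^o;
  chainP : chain_coef \in is_chain
}.

HB.instance Definition _ := [isSub for chain_coef].
HB.instance Definition _ := [Choice of chain by <:].
HB.instance Definition _ := [SubChoice_isSubLmodule of chain by <:].

(* The oriented simplex [v_0, ..., v_k] as a chain: coefficient sgn tau on the
   reordering of s by tau, and 0 on the orderings of other simplices. *)
Definition oriented_coef (s : osimplex X k) : osimplex X k -> R^o :=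
  fun t => \sum_(tau : 'S_k.+1) (-1) ^+ tau * (t == reorder s tau)%:R.

Fact oriented_subproof s : oriented_coef s \in is_chain.
Proof.
apply/asboolP; split=> [t rho|].
  rewrite /oriented_coef big_distrr /= (reindex_inj (mulgI rho)) /=.
  apply: eq_bigr => tau _; rewrite odd_permM signr_addb mulrA -reorderM.
  congr (_ * (_ : bool)%:R); apply/eqP/eqP => [|->//].
  move=> /(congr1 (fun u => reorder u (rho^-1)%g)).
  by rewrite ![reorder (reorder _ rho) _]reorderM mulVg !reorder1.
apply: (@sub_finite_set _ _ [set` [seq reorder s tau | tau : 'S_k.+1]]) => //.
move=> t /=; apply: contraNT => tN; rewrite /oriented_coef big1 // => tau _.
by case: eqP => [e|]; rewrite ?mulr0 //; rewrite e codom_f in tN.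
Qed.

Definition oriented (s : osimplex X k) : chain := Chain (oriented_subproof s).

Lemma chain_reorder (c : chain) s tau : c (reorder s tau) = (-1) ^+ tau * c s.
Proof. by have /asboolP[] := chainP c. Qed.

Lemma chain_finite (c : chain) : finite_set [set s | c s != 0].
Proof. by have /asboolP[] := chainP c. Qed.

Lemma oriented_reorder s tau :
  oriented (reorder s tau) = (-1) ^+ tau *: oriented s.
Proof.
apply/val_inj/funext => t.
change (oriented_coef (reorder s tau) t = (-1) ^+ tau * oriented_coef s t).
rewrite /oriented_coef big_distrr /= [RHS](reindex_inj (mulIg tau)) /=.
apply: eq_bigr => rho _.
by rewrite odd_permM signr_addb reorderM mulrA mulrCA mulrA -mulrA -signr_addb
  addbb mulr1 -?mulrA.
Qed.

Lemma chain_generated (c : chain) : exists r : seq (osimplex X k),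
  c = \sum_(s <- r) ((k.+1)`!%:R^-1 * c s) *: oriented s.
Proof.
have n0 : (k.+1)`!%:R != 0 :> R.
  by rewrite Num.Theory.pnatr_eq0 -lt0n fact_gt0.
pose r := fset_set [set s | c s != 0]; exists r; apply/val_inj/funext => t.
have -> : val (\sum_(s <- r) ((k.+1)`!%:R^-1 * c s) *: oriented s) t =
          \sum_(s <- r) ((k.+1)`!%:R^-1 * c s) * oriented_coef s t.
  by elim: (r : seq _) => [|s r' IH]; rewrite ?big_nil // !big_cons -IH.
rewrite -[val c t]/(c t); apply: (mulfI n0); rewrite mulr_sumr.
under eq_bigr do rewrite -mulrA mulVKf // /oriented_coef mulr_sumr.
rewrite exchange_big /= mulr_natl -card_Sn -sumr_const; apply: eq_bigr => tau _.
pose u := reorder t tau^-1%g.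
have tE s : (t == reorder s tau) = (s == u).
  apply/eqP/eqP => e; first by rewrite /u e reorderM mulVg reorder1.
  by rewrite e /u reorderM mulgV reorder1.
under eq_bigr do rewrite tE.
have ur : c u != 0 -> u \in (r : {fset _}).
  by move=> cu; rewrite in_fset_set ?inE //; exact: chain_finite.
have ct : c t = c u * (-1) ^+ tau.
  by rewrite chain_reorder odd_permV mulrAC -signr_addb addbb mul1r.
have [cu0|cu] := eqVneq (c u) 0.
  rewrite ct cu0 mul0r big1 // => s _.
  by case: eqP => [->|]; rewrite ?cu0 ?mul0r ?mulr0.
rewrite (bigD1_seq u) ?ur ?fset_uniq //= eqxx mulr1 -ct big1 ?addr0 //.
by move=> s /negPf ->; rewrite !mulr0.
Qed.

(* The space C^k(X): the pairing of a cochain with a chain is application. *)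
Definition cochain := {scalar chain}.

(* Linear extension to chains of an alternating function w of the ordered
   simplices (see extendE): each simplex has (k+1)! orderings, which all
   contribute the same term. *)
Definition extend (w : osimplex X k -> R) (c : chain) : R :=
  (k.+1)`!%:R^-1 * \sum_(s \in [set: osimplex X k]) w s * c s.

Lemma extend_widen w (c : chain) (S : set (osimplex X k)) :
  finite_set S -> [set s | c s != 0] `<=` S ->
  extend w c = (k.+1)`!%:R^-1 * \sum_(s <- fset_set S) w s * c s.
Proof.
move=> Sfin cS; rewrite /extend; congr (_ * _); rewrite -fsbig_finite //.
apply/esym/fsbig_widen => // s [_ /= nS].
by have [->|/cS//] := eqVneq (c s) 0; rewrite mulr0.
Qed.

Fact extend_is_scalar w : scalar (extend w).
Proof.
move=> a c d.
pose S := [set s | c s != 0] `|` [set s | d s != 0].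
have Sfin : finite_set S by rewrite finite_setU; split; exact: chain_finite.
rewrite !(@extend_widen w _ S) //.
- rewrite mulrCA -mulrDr; congr (_ * _).
  rewrite big_distrr -big_split /=; apply: eq_bigr => s _.
  change (w s * (a * c s + d s) = a * (w s * c s) + w s * d s).
  by rewrite mulrDr mulrCA.
- by move=> s; right.
- by move=> s; left.
- move=> s /=; change (a * c s + d s != 0 -> S s) => h.
  case: (eqVneq (c s) 0) => [c0|]; last by left.
  by right; apply: contra h => /eqP ->; rewrite c0 mulr0 addr0.
Qed.

HB.instance Definition _ w :=
  GRing.isLinear.Build R chain R *%R (extend w) (extend_is_scalar w).

Lemma extendE w s :
  (forall t (tau : 'S_k.+1), w (reorder t tau) = (-1) ^+ tau * w t) ->
  extend w (oriented s) = w s.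
Proof.
move=> wP; have n0 : (k.+1)`!%:R != 0 :> R.
  by rewrite Num.Theory.pnatr_eq0 -lt0n fact_gt0.
apply: (mulfI n0); rewrite /extend mulVKf //.
pose r := [seq reorder s tau | tau : 'S_k.+1].
have rU : uniq r by rewrite map_inj_uniq ?enum_uniq //; exact: reorder_inj.
rewrite (fsbigE r) //=; last first.
  move=> t _ tN; rewrite /oriented_coef big1 ?mulr0 // => tau _.
  by case: eqP => [e|]; rewrite ?mulr0 //; rewrite e codom_f in tN.
under eq_bigl do rewrite in_setT.
rewrite big_map big_enum /= (eq_bigr (fun=> w s)); last first.
  move=> tau _; rewrite wP /oriented_coef (bigD1 tau) //= eqxx big1 ?addr0.
    by rewrite mulr1 mulrAC -signr_addb addbb mul1r.
  move=> rho /negPf nrho; rewrite (inj_eq (@reorder_inj _ _ _ s)) eq_sym nrho.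
  by rewrite mulr0.
by rewrite sumr_const card_Sn mulr_natl.
Qed.

End Chains.

Section Products.
Variables (R : realType) (V : choiceType) (X : simplicial_complex V).
Variables (k l : nat) (a : cochain R X k) (b : cochain R X l).

(* The cup product depends on the ordering, not only on the orientation. *)
Definition cup (s : osimplex X (k + l)) : R :=
  a (oriented R (front s)) * b (oriented R (back s)).

Definition alt_cup (s : osimplex X (k + l)) : R :=
  ((k + l).+1)`!%:R^-1 *
    \sum_(tau : 'S_(k + l).+1) (-1) ^+ tau * cup (reorder s tau).

Definition wedge : cochain R X (k + l) := extend alt_cup.

Lemma alt_cup_reorder s (tau : 'S_(k + l).+1) :
  alt_cup (reorder s tau) = (-1) ^+ tau * alt_cup s.
Proof.
rewrite /alt_cup mulrCA; congr (_ * _).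
rewrite big_distrr /= [RHS](reindex_inj (mulIg tau)) /=.
apply: eq_bigr => rho _.
by rewrite odd_permM addbC signr_addb reorderM !mulrA -signr_addb addbb mul1r.
Qed.

Lemma wedgeE s : wedge (oriented R s) = alt_cup s.
Proof. exact: extendE alt_cup_reorder. Qed.

End Products.

(* Label the vertices of a (k+l)-simplex 0, ..., k+l by the ordering s, and let
   A, {v}, B partition the labels, with #|A| = k and #|B| = l. Given an
   orientation p of the simplex on A :|: {v} and an orientation q of the simplex
   on {v} :|: B, the ordering (A, v, B) is even if, for an ordering rho that
   lists A, then v, then B,
     p = e [rho 0, ..., rho k], q = e' [rho k, ..., rho (k+l)],
   where the signs e, e' satisfy e * e' * sgn rho = 1. This does not depend on
   the choice of rho, and for e = e' = 1 it says that rho is even. The signs are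
   needed since an even rho whose parts have given orientations need not exist:
   for A = {i}, B = {j} there is only one rho. *)
Definition even_ordering (V : choiceType) (X : simplicial_complex V) (k l : nat)
    (s : osimplex X (k + l)) (A : {set 'I_(k + l).+1}) (v : 'I_(k + l).+1)
    (B : {set 'I_(k + l).+1}) (p : osimplex X k) (q : osimplex X l) : Prop :=
  exists (rho : 'S_(k + l).+1) (e : 'S_k.+1) (e' : 'S_l.+1),
    [/\ [set rho i | i : 'I_(k + l).+1 & (i < k)%N]%SET = A,
        rho (mid_idx k l) = v,
        [set rho i | i : 'I_(k + l).+1 & (k < i)%N]%SET = B,
        p = reorder (front (reorder s rho)) e /\
        q = reorder (back (reorder s rho)) e'
      & (-1) ^+ e * (-1) ^+ e' * (-1) ^+ rho = 1 :> int].

(* Main.v *)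
(* Group the permutations tau by the pair formed by the set tau @: S, where S
   consists of the first k + 1 (resp. last l + 1) positions, and by the middle
   vertex tau k. The signed cup product is constant on each group, because two
   of its members differ by a permutation of the first k positions and one of
   the last l positions, whose signs are absorbed by alpha and beta. All groups
   have the same size, as translates of the stabilizer of (S, k), so the average
   over all permutations is the average over the pairs (f, v). *)
Require Import Defs.
From mathcomp Require Import all_boot all_order all_fingroup all_algebra.
From mathcomp Require Import reals.

Set Implicit Arguments.
Unset Strict Implicit.
Unset Printing Implicit Defensive.

Import GRing.Theory.
Local Open Scope ring_scope.

(** * Permutations transported along an injection *)

(** Write [e] as a product of transpositions and replace each [(x y)] by [(g x g y)]; the number of
    factors, hence the parity, is unchanged. *)
Lemma perm_extend (T U : finType) (g : T -> U) (e : {perm T}) :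
  injective g ->
  exists e' : {perm U}, [/\ forall i, e' (g i) = g (e i),
    forall j, j \notin codom g -> e' j = j & odd_perm e' = odd_perm e].
Proof.
move=> injg; have [ts -> _] := prod_tpermP e.
elim: ts => [|[x y] ts [e' [e'g e'N e'odd]]].
  by rewrite big_nil; exists 1%g; split=> [i|j _|]; rewrite ?perm1 ?odd_perm1.
rewrite big_cons; exists (tperm (g x) (g y) * e')%g; split=> [i|j jN|].
- by rewrite !permM -inj_tperm // e'g.
- by rewrite permM tpermD ?e'N //; apply: contraNneq jN => <-; exact: codom_f.
- by rewrite !odd_permM e'odd !odd_tperm (inj_eq injg).
Qed.

(** The map sending [i] to the [g]-preimage of [pi (g i)] is injective, hence a permutation of the
    finite type [T]. *)
Lemma perm_restrict (T U : finType) (g : T -> U) (pi : {perm U}) :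
  injective g -> (forall i, pi (g i) \in codom g) ->
  exists e : {perm T}, forall i, g (e i) = pi (g i).
Proof.
move=> injg pig; pose h i := iinv (pig i).
have hE i : g (h i) = pi (g i) by exact: f_iinv.
have injh : injective h by move=> i j /(congr1 g); rewrite !hE => /perm_inj/injg.
by exists (perm injh) => i; rewrite permE.
Qed.

(** * Averaging over permutations grouped by flags *)

Section PermFlag.
Variables (F : numFieldType) (T : finType) (S : {set T}) (m : T).
Hypothesis mS : m \in S.

Let stab := [set pi : {perm T} | (pi @: S == S) && (pi m == m)].

(** The fibre of [flag] through [rho] is the coset [stab * rho], on which [H] is constant. *)
Lemma sum_perm_flag (H : {perm T} -> F) (G : {set T} -> T -> F) :
  (forall pi tau : {perm T}, pi @: S = S -> pi m = m ->
     H (pi * tau)%g = H tau) ->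
  (forall (f : {set T}) v, #|f| = #|S| -> v \in f ->
     exists tau : {perm T}, [/\ tau @: S = f, tau m = v & H tau = G f v]) ->
  \sum_tau H tau =
    #|stab|%:R * \sum_(f : {set T} | #|f| == #|S|) \sum_(v in f) G f v.
Proof.
move=> Hstab HG; rewrite pair_big_dep /=.
pose flag (tau : {perm T}) := (tau @: S, tau m).
rewrite (partition_big flag
           (fun fv => (#|fv.1| == #|S|) && (fv.2 \in fv.1))) /=; last first.
  by move=> tau _; rewrite card_imset ?eqxx ?imset_f //; exact: perm_inj.
rewrite big_distrr; apply: eq_bigr => -[f v] /= /andP[/eqP fS vf].
have [rho [rhoS rhom <-]] := HG f v fS vf.
(* Translating by [rho] turns the fibre into [stab], so each flag contributes [#|stab|] equal
   terms. *)
rewrite (reindex_inj (mulIg rho)) mulr_natl -sumr_const /=.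
apply: eq_big => [pi|pi]; last first.
  rewrite /flag xpair_eqE -rhoS -rhom permM (inj_eq perm_inj) => /andP[+ /eqP pim].
  rewrite (eq_imset _ (permM pi rho)) imset_comp.
  by rewrite (inj_eq (imset_inj perm_inj)) => /eqP piS; exact: Hstab.
rewrite /flag inE xpair_eqE -rhoS -rhom permM (inj_eq perm_inj).
by rewrite (eq_imset _ (permM pi rho)) imset_comp (inj_eq (imset_inj perm_inj)).
Qed.

Lemma perm_flag_average (H : {perm T} -> F) (G : {set T} -> T -> F) :
  (forall pi tau : {perm T}, pi @: S = S -> pi m = m ->
     H (pi * tau)%g = H tau) ->
  (forall (f : {set T}) v, #|f| = #|S| -> v \in f ->
     exists tau : {perm T}, [/\ tau @: S = f, tau m = v & H tau = G f v]) ->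
  #|T|`!%:R^-1 * \sum_tau H tau =
    'C(#|T|, #|S|)%:R^-1 *
      \sum_(f : {set T} | #|f| == #|S|) #|S|%:R^-1 * \sum_(v in f) G f v.
Proof.
move=> Hstab HG; rewrite (sum_perm_flag Hstab HG) -mulr_sumr !mulrA.
congr (_ * _).
(* The order of [stab] is found by double counting: the same identity for constant [1] gives
   [#|T|! = #|stab| * 'C(#|T|, #|S|) * #|S|]. *)
have : \sum_(tau : {perm T}) 1 = #|stab|%:R *
    \sum_(f : {set T} | #|f| == #|S|) \sum_(v in f) (1 : F).
  apply: sum_perm_flag => // f v fS vf.
  by have [tau [tS tm _]] := HG f v fS vf; exists tau.
have -> : \sum_(tau : {perm T}) 1 = #|T|`!%:R :> F.
  rewrite sumr_const -[in RHS]cardsT -card_perm; congr _%:R.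
  by apply: eq_card => tau; apply/esym/subsetP => x; rewrite inE.
have -> : \sum_(f : {set T} | #|f| == #|S|) \sum_(v in f) 1 =
    ('C(#|T|, #|S|) * #|S|)%:R :> F.
  rewrite (eq_bigr (fun=> #|S|%:R)) => [|f /eqP <-]; last by rewrite sumr_const.
  by rewrite sumr_const -card_draws cardsE natrM mulr_natl.
rewrite natrM => ->.
(* The identity lies in [stab], so its order can be cancelled. *)
have N0 : #|stab|%:R != 0 :> F.
  rewrite Num.Theory.pnatr_eq0 -lt0n; apply/card_gt0P; exists 1%g.
  rewrite inE perm1 eqxx andbT (eq_imset (g := id)) ?imset_id //.
  exact: perm1.
by rewrite !invfM mulrAC mulrAC mulrC !mulrA mulfV // mul1r mulrC.
Qed.

End PermFlag.

(** * Invariance of the signed cup product *)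

Lemma signr_mulACA (R : comNzRingType) (b c d : bool) (x y : R) :
  (-1) ^+ (b (+) c (+) d) * ((-1) ^+ b * x * ((-1) ^+ c * y)) =
  (-1) ^+ d * (x * y).
Proof.
by rewrite [X in _ * X]mulrACA -signr_addb [LHS]mulrA -signr_addb addbAC addbb addFb.
Qed.

Section SignedCup.
Variables (R : realType) (V : choiceType) (X : simplicial_complex V).
Variables (k l : nat) (a : cochain R X k) (b : cochain R X l).
Variable (s : osimplex X (k + l)).

Lemma cochain_reorder n (c : cochain R X n) (t : osimplex X n) (e : 'S_n.+1) :
  c (oriented R (reorder t e)) = (-1) ^+ e * c (oriented R t).
Proof. by rewrite oriented_reorder linearZ. Qed.

Lemma val_front_idx (i : 'I_k.+1) : front_idx l i = i :> nat.
Proof. by rewrite inordK // ltnS (leq_trans (leq_ord _) (leq_addr _ _)). Qed.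

Lemma val_back_idx (i : 'I_l.+1) : back_idx k i = (k + i)%N :> nat.
Proof. by rewrite inordK // ltnS leq_add2l leq_ord. Qed.

Lemma val_mid_idx : mid_idx k l = k :> nat.
Proof. by rewrite inordK // ltnS leq_addr. Qed.

Lemma codom_front_idx (i : 'I_(k + l).+1) :
  (i \in codom (@front_idx k l)) = (i <= k)%N.
Proof.
apply/codomP/idP => [[j ->]|ik]; first by rewrite val_front_idx leq_ord.
by exists (inord i); apply/val_inj; rewrite /= val_front_idx inordK.
Qed.

Lemma codom_back_idx (i : 'I_(k + l).+1) :
  (i \in codom (@back_idx k l)) = (k <= i)%N.
Proof.
apply/codomP/idP => [[j ->]|ki]; first by rewrite val_back_idx leq_addr.
exists (inord (i - k)); apply/val_inj; rewrite /= val_back_idx inordK ?subnKC //.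
by rewrite ltnS leq_subLR leq_ord.
Qed.

Definition signed_cup (tau : 'S_(k + l).+1) : R :=
  (-1) ^+ tau * cup a b (reorder s tau).

(** Such a [pi] splits into a permutation of the front positions and one of the back positions, both
    fixing position [k]. Their signs occur once in the sign of [pi] and once through the alternation
    of [a] and [b], so they cancel. *)
Lemma signed_cup_stab (pi tau : 'S_(k + l).+1) :
  pi (mid_idx k l) = mid_idx k l ->
  (forall i, (pi i <= k)%N = (i <= k)%N) ->
  signed_cup (pi * tau)%g = signed_cup tau.
Proof.
move=> pim pile.
have pieq i : (pi i == k :> nat) = (i == k :> nat).
  have := inj_eq (@perm_inj _ pi) i (mid_idx k l).
  by rewrite pim -!val_eqE /= val_mid_idx.
have pige i : (k <= pi i)%N = (k <= i)%N.
  by move: (pieq i) (pile i); case: ltngtP => _; case: ltngtP.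
have [|e eE] := perm_restrict (pi := pi) (@front_idx_inj k l).
  by move=> i; rewrite codom_front_idx pile -codom_front_idx codom_f.
have [|d dE] := perm_restrict (pi := pi) (@back_idx_inj k l).
  by move=> i; rewrite codom_back_idx pige -codom_back_idx codom_f.
have [e' [e'E e'N oe]] := perm_extend e (@front_idx_inj k l).
have [d' [d'E d'N od]] := perm_extend d (@back_idx_inj k l).
(* [e'] acts first. A position below [k] stays below [k], where [d'] is the identity; position [k]
   is fixed by both; a position above [k] is moved by [d'] only. *)
have piE : pi = (e' * d')%g.
  apply/permP => i; rewrite permM; case: (leqP i k) => ik.
    have e'i : e' i = pi i.
      move: (ik); rewrite -codom_front_idx => /codomP[j ->].
      by rewrite e'E eE.
    rewrite e'i; have [im|ni] := eqVneq i (mid_idx k l).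
      have: mid_idx k l \in codom (@back_idx k l).
        by rewrite codom_back_idx val_mid_idx.
      by rewrite im pim => /codomP[j mj]; rewrite mj d'E dE -mj pim.
    rewrite d'N // codom_back_idx pige -ltnNge ltn_neqAle ik andbT.
    by move: ni; rewrite -val_eqE /= val_mid_idx.
  rewrite e'N ?codom_front_idx -?ltnNge //.
  move: (ltnW ik); rewrite -codom_back_idx => /codomP[j ->].
  by rewrite d'E dE.
rewrite /signed_cup /cup.
have -> : front (reorder s (pi * tau)%g) = reorder (front (reorder s tau)) e.
  by apply/val_inj/ffunP => i; rewrite !ffunE permM -eE.
have -> : back (reorder s (pi * tau)%g) = reorder (back (reorder s tau)) d.
  by apply/val_inj/ffunP => i; rewrite !ffunE permM -dE.
rewrite (cochain_reorder a) (cochain_reorder b) odd_permM {1}piE odd_permM oe od.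
exact: signr_mulACA.
Qed.

(** The ordering [rho] provided by [even_ordering] serves as [tau]: the sign condition makes its
    sign equal to the sign relating [p] and [q] to its front and back faces. *)
Lemma even_ordering_signed_cup A v B (p : osimplex X k) (q : osimplex X l) :
  even_ordering s A v B p q ->
  exists tau : 'S_(k + l).+1, [/\
    tau @: [set i : 'I_(k + l).+1 | (i <= k)%N] = v |: A,
    tau @: [set i : 'I_(k + l).+1 | (k <= i)%N] = v |: B,
    tau (mid_idx k l) = v &
    signed_cup tau = a (oriented R p) * b (oriented R q)].
Proof.
move=> [rho [e [e' [<- <- <- [-> ->] sgn]]]]; exists rho; split=> //.
- rewrite -imsetU1 (_ : [set _ | _] = mid_idx k l |: [set i : 'I__ | (i < k)%N]) //.
  by apply/setP => i; rewrite !inE leq_eqVlt -val_eqE /= val_mid_idx.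
- rewrite -imsetU1 (_ : [set _ | _] = mid_idx k l |: [set i : 'I__ | (k < i)%N]) //.
  by apply/setP => i; rewrite !inE leq_eqVlt -val_eqE /= val_mid_idx [k == _]eq_sym.
rewrite /signed_cup /cup (cochain_reorder a) (cochain_reorder b).
rewrite [RHS]mulrACA -signr_addb; congr (_ ^+ _ * _).
(* The condition on signs, stated in [int], is turned into an equality of parities by cases. *)
by move: sgn; do 3!case: (odd_perm _).
Qed.

Lemma card_front_idx : #|[set i : 'I_(k + l).+1 | (i <= k)%N]| = (k + 1)%N.
Proof.
rewrite addn1 -[RHS](card_ord k.+1) -(card_codom (@front_idx_inj k l)) cardsE.
by apply: eq_card => i; rewrite codom_front_idx.
Qed.

Lemma card_back_idx : #|[set i : 'I_(k + l).+1 | (k <= i)%N]| = (l + 1)%N.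
Proof.
rewrite addn1 -[RHS](card_ord l.+1) -(card_codom (@back_idx_inj k l)) cardsE.
by apply: eq_card => i; rewrite codom_back_idx.
Qed.

End SignedCup.

(** * The two formulas as averages over flags *)

Theorem proposition4p7 (R : realType) (V : choiceType)
    (X : simplicial_complex V) (k l : nat)
    (a : cochain R X k) (b : cochain R X l) (s : osimplex X (k + l)) :
  (forall (p : {set 'I_(k + l).+1} -> osimplex X k)
          (q : {set 'I_(k + l).+1} -> 'I_(k + l).+1 -> osimplex X l),
    (forall (f : {set 'I_(k + l).+1}) (v : 'I_(k + l).+1),
       #|f| = (k + 1)%N -> v \in f ->
       even_ordering s (f :\ v) v (~: f) (p f) (q f v)) ->
    wedge a b (oriented R s) =
      'C(k + l + 1, k + 1)%:R^-1 *
        \sum_(f : {set 'I_(k + l).+1} | #|f| == (k + 1)%N)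
          a (oriented R (p f)) *
            ((k + 1)%:R^-1 * \sum_(v in f) b (oriented R (q f v)))) /\
  (forall (p : {set 'I_(k + l).+1} -> 'I_(k + l).+1 -> osimplex X k)
          (q : {set 'I_(k + l).+1} -> osimplex X l),
    (forall (f : {set 'I_(k + l).+1}) (v : 'I_(k + l).+1),
       #|f| = (l + 1)%N -> v \in f ->
       even_ordering s (~: f) v (f :\ v) (p f v) (q f)) ->
    wedge a b (oriented R s) =
      'C(k + l + 1, l + 1)%:R^-1 *
        \sum_(f : {set 'I_(k + l).+1} | #|f| == (l + 1)%N)
          ((l + 1)%:R^-1 * \sum_(v in f) a (oriented R (p f v))) *
            b (oriented R (q f))).
Proof.
have wedge_signed : wedge a b (oriented R s) =
    #|'I_(k + l).+1|`!%:R^-1 * \sum_tau signed_cup a b s tau.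
  by rewrite wedgeE card_ord.
split=> p q pq; rewrite wedge_signed.
  pose S := [set i : 'I_(k + l).+1 | (i <= k)%N].
  have cS : #|S| = (k + 1)%N := card_front_idx k l.
  rewrite (@perm_flag_average _ _ S (mid_idx k l) _ _
             (fun f v => a (oriented R (p f)) * b (oriented R (q f v)))).
  (* The factor from [a] does not depend on [v] and leaves the inner sum. *)
  - rewrite cS card_ord (addn1 (k + l)); congr (_ * _); apply: eq_bigr => f _.
    by rewrite -mulr_sumr mulrCA.
  - by rewrite inE val_mid_idx.
  - move=> pi tau piS pim; apply: signed_cup_stab => // i.
    by have := mem_imset S i (@perm_inj _ pi); rewrite piS !inE.
  - move=> f v; rewrite cS => fk vf.
    have [tau [tS _ tm tE]] := even_ordering_signed_cup a b (pq f v fk vf).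
    by exists tau; rewrite tS setD1K.
(* For the second formula the flags use the last [l + 1] positions, so [f] carries [b]. *)
pose S := [set i : 'I_(k + l).+1 | (k <= i)%N].
have cS : #|S| = (l + 1)%N := card_back_idx k l.
rewrite (@perm_flag_average _ _ S (mid_idx k l) _ _
           (fun f v => a (oriented R (p f v)) * b (oriented R (q f)))).
- rewrite cS card_ord (addn1 (k + l)); congr (_ * _); apply: eq_bigr => f _.
  by rewrite -mulr_suml mulrA.
- by rewrite inE val_mid_idx.
- move=> pi tau piS pim; apply: signed_cup_stab => // i.
  (* Preserving the positions [>= k] and fixing [k] amounts to preserving the positions [<= k] and
     fixing [k]. *)
  have := mem_imset S i (@perm_inj _ pi); rewrite piS !inE.
  have := inj_eq (@perm_inj _ pi) i (mid_idx k l); rewrite pim -!val_eqE /=.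
  by rewrite val_mid_idx; case: ltngtP => _; case: ltngtP.
- move=> f v; rewrite cS => fl vf.
  have [tau [_ tS tm tE]] := even_ordering_signed_cup a b (pq f v fl vf).
  by exists tau; rewrite tS setD1K.
Qed.
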